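(* For two gate verdicts $\mathbf{1}_1,\mathbf{1}_2$ on an erroneous instance with latent false-accept rate $\alpha\sim G$, $$\rho_v:=\mathrm{Corr}(\mathbf{1}_1,\mathbf{1}_2)=\frac{\mathrm{Var}(\alpha)}{\bar\alpha(1-\bar\alpha)},$$ where $\bar\alpha=\mathbb{E}_{\alpha\sim G}[\alpha]$; and for $G=\mathrm{Beta}(a,b)$ this equals $\frac{1}{a+b+1}$. The limit $\rho_v\to0$ (with $\bar\alpha$ fixed) recovers the Odds Law; the limit $\rho_v\to1$ recovers a two-point blind-spot model ($\alpha\in\{0,1\}$), where gates either succeed immediately or never.
   Context: $G$ is a probability distribution supported on $[0,1]$. Given $\alpha$, the gate verdicts on an erroneous answer are i.i.d. Bernoulli$(\alpha)$, with $1$ meaning accept. A candidate answer has prior log-odds of correctness $\ell_0$, correct answers are always accepted, and $\ell_k=\ell_0-\ln\mathbb{E}_{\alpha\sim G}[\alpha^k]$ is the posterior log-odds of correctness given that $k$ gates all accept. The Odds Law is the linear law $\ell_k=\ell_0+k\ln\Lambda$ with $\Lambda=1/\bar\alpha$, which is the case $G=\delta_{\bar\alpha}$ (a point mass). A blind spot is an error the verifier never catches ($\alpha=1$). *)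

(* Defs.v *)
From HB Require Import structures.
From mathcomp Require Import all_boot all_order all_algebra.
From mathcomp Require Import all_classical all_reals all_analysis.

Set Implicit Arguments.
Unset Strict Implicit.
Unset Printing Implicit Defensive.

Import Order.TTheory GRing.Theory Num.Theory.
Import numFieldNormedType.Exports.

Local Open Scope classical_set_scope.
Local Open Scope ring_scope.

Definition bit (R : realType) (b : bool) : R := b%:R.

Lemma measurable_bit (R : realType) : measurable_fun [set: bool] (@bit R).
Proof. by []. Qed.

HB.instance Definition _ (R : realType) :=
  isMeasurableFun.Build _ _ _ _ (@bit R) (@measurable_bit R).

(* Verdicts on one erroneous instance: [verdict i] is the verdict of gate i,
   [true] meaning accept.  The last field says that, given alpha, the verdicts
   are i.i.d. Bernoulli(alpha): a version of the conditional probability, given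
   the sigma-algebra of alpha, that the first k verdicts are v 0, ..., v (k-1)
   is the product of the Bernoulli(alpha) masses of the v i.  The factors are
   nonnegative almost surely by [alpha_supp]. *)
Record gateModel (R : realType) := GateModel {
  disp : measure_display ;
  space : measurableType disp ;
  prob : probability space R ;
  alpha : {RV prob >-> R} ;
  verdict : nat -> {RV prob >-> bool} ;
  alpha_supp : distribution prob alpha `[0, 1] = 1%E ;
  verdict_iid : forall (k : nat) (v : nat -> bool) (B : set R), measurable B ->
    prob (alpha @^-1` B `&` [set t | forall i, (i < k)%N -> verdict i t = v i])
    = (\int[prob]_(t in alpha @^-1` B)
         (\prod_(i < k) bernoulli_pmf (alpha t) (v i))%:E)%E }.

Section gates.
Context {R : realType}.

Definition latent_law (M : gateModel R) : probability R R :=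
  distribution (prob M) (alpha M).

Definition mean (G : probability R R) : R := fine 'E_G[(fun x : R => x)].

Definition var (G : probability R R) : R := fine 'V_G[(fun x : R => x)].

Definition correlation (d : measure_display) (T : measurableType d)
    (P : probability T R) (X Y : T -> R) : R :=
  fine (covariance P X Y)
  / (Num.sqrt (fine 'V_P[X]) * Num.sqrt (fine 'V_P[Y])).

Definition rho_v (M : gateModel R) (i j : nat) : R :=
  correlation (prob M) (@bit R \o verdict M i) (@bit R \o verdict M j).

(* Beta(a, b) for real parameters; the library's [beta_prob] only has natural
   number parameters. *)
Definition beta_kernel (a b x : R) : R := x `^ (a - 1) * (1 - x) `^ (b - 1).

Definition beta_norm (a b : R) : R :=
  fine (\int[lebesgue_measure]_(x in `]0%R, 1%R[) (beta_kernel a b x)%:E)%E.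

Definition is_beta (a b : R) (G : probability R R) : Prop :=
  forall A : set R, measurable A ->
    G A = (\int[lebesgue_measure]_(x in A `&` `]0%R, 1%R[)
             (beta_kernel a b x / beta_norm a b)%:E)%E.

Definition log_odds (G : probability R R) (l0 : R) (k : nat) : R :=
  l0 - ln (fine 'E_G[(fun x : R => x ^+ k)]).

Definition odds_law (l0 Lambda : R) (k : nat) : R := l0 + k%:R * ln Lambda.

Definition weak_cvg (G : nat -> probability R R) (H : probability R R) : Prop :=
  forall f : R -> R, continuous f -> (exists C, forall x, `|f x| <= C) ->
    ('E_(G n)[f] @[n --> \oo] --> 'E_H[f])%E.

Definition point_mass (p : R) : probability R R := \d_p.

(* For 0 <= p <= 1, the law (1 - p) delta_0 + p delta_1. *)
Definition two_point (p : R) : probability R R :=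
  distribution (bernoulli_prob p) (@bit R).

End gates.

(* Main.v *)
(* Conditionally on alpha the verdicts are independent Bernoulli(alpha), so
   P(1_i = 1) = E[alpha] and P(1_i = 1_j = 1) = E[alpha^2]: the covariance of
   two verdicts is Var(alpha), and each verdict has variance abar (1 - abar).
   For Beta(a, b), the derivative of x^a (1 - x)^b integrates to 0, which gives
   a E[1 - alpha] = b E[alpha] and (a + 1) E[alpha (1 - alpha)] = b E[alpha^2].
   Both limits are one concentration argument: on [0, 1], a continuous g
   vanishing on the zeros of a continuous q >= 0 satisfies |g| <= eps + K q, so
   E[q] -> 0 forces E[g] -> 0.  Take q = (x - abar)^2, with E[q] = Var(alpha),
   when rho -> 0, and q = x (1 - x), with E[q] = abar (1 - abar) (1 - rho), when
   rho -> 1; the latter is also the probability that one gate accepts and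
   another rejects. *)

Require Import Defs.
From HB Require Import structures.
From mathcomp Require Import all_boot all_order all_algebra.
From mathcomp Require Import all_classical all_reals all_analysis.
From mathcomp Require Import measurable_realfun ring lra.

Import Order.TTheory GRing.Theory Num.Theory.
Import numFieldNormedType.Exports.

Local Open Scope classical_set_scope.
Local Open Scope ring_scope.

(** * Integration against a law carried by [[0, 1]] *)

Section unit_law.
Context {R : realType} (G : probability R R).
Hypothesis G01 : G `[0, 1]%classic = 1%E.
Implicit Types f g : R -> R.

Lemma unit_law_outside : G (~` `[0, 1]%classic) = 0%E.
Proof. by rewrite probability_setC// G01 subee. Qed.

(** The complement of [[0, 1]] is [G]-null, and a continuous function is bounded on this compact
    segment. Continuity is then the only side condition of the linear calculus below. *)
Lemma unit_law_integrable f : continuous f ->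
  G.-integrable setT (EFin \o f).
Proof.
move=> cf; have mf : measurable_fun setT f by exact: continuous_measurable_fun.
apply/(negligible_integrable (measurableC (measurable_itv `[0, 1]))) => //.
- exact/measurable_EFinP.
- exact: unit_law_outside.
rewrite setDE setTI setCK; apply: measurable_bounded_integrable => //.
- by rewrite [X in (X < _)%E]G01 ltry.
- exact: measurable_funTS.
- have /compact_bounded[M [Mr HM]] := continuous_compact
    (continuous_subspaceT cf) (@segment_compact R 0 1).
  exists M; split => // N MN x x01.
  by apply: HM => //; exists x.
Qed.

(** Both integrals reduce to [[0, 1]], so a comparison there is enough. *)
Lemma unit_law_le f g : continuous f -> continuous g ->
  (forall x, 0 <= x <= 1 -> f x <= g x) ->
  \int[G]_x f x <= \int[G]_x g x.
Proof.
move=> cf cg fg.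
have restr h : continuous h -> \int[G]_x h x = \int[G]_(x in `[0, 1]) h x.
  move=> ch; rewrite /Rintegral.
  rewrite (negligible_integral (measurableC (measurable_itv `[0, 1])))//.
  - by rewrite setDE setTI setCK.
  - exact: unit_law_integrable.
  - exact: unit_law_outside.
rewrite !restr//; apply: le_Rintegral => //.
- by apply: integrableS (unit_law_integrable _ cf).
- by apply: integrableS (unit_law_integrable _ cg).
Qed.

Lemma unit_lawD f g : continuous f -> continuous g ->
  \int[G]_x (f x + g x) = \int[G]_x f x + \int[G]_x g x.
Proof. by move=> cf cg; rewrite RintegralD//; exact: unit_law_integrable. Qed.

Lemma unit_lawB f g : continuous f -> continuous g ->
  \int[G]_x (f x - g x) = \int[G]_x f x - \int[G]_x g x.
Proof. by move=> cf cg; rewrite RintegralB//; exact: unit_law_integrable. Qed.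

Lemma unit_lawZ (c : R) f : continuous f ->
  \int[G]_x (c * f x) = c * \int[G]_x f x.
Proof. by move=> cf; rewrite RintegralZl//; exact: unit_law_integrable. Qed.

Lemma unit_law_cst (c : R) : \int[G]_x c = c.
Proof. by rewrite Rintegral_cst// [X in fine X]probability_setT mulr1. Qed.

Lemma unit_law_expectation f : continuous f ->
  ('E_G[f])%E = (\int[G]_x f x)%:E.
Proof.
move=> cf; rewrite unlock fineK//; apply: integrable_fin_num => //.
exact: unit_law_integrable.
Qed.

Lemma mean_unit_law : mean G = \int[G]_x x.
Proof. by rewrite /mean unlock. Qed.

Lemma var_unit_law : var G = \int[G]_x (x ^+ 2) - mean G ^+ 2.
Proof.
have cX : continuous (fun x : R => x ^+ 2) by exact: exprn_continuous.
have c1 : continuous (fun x : R => x) by move=> x; exact: cvg_id.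
rewrite /var /variance covarianceE; last 3 first.
- by apply/Lfun1_integrable; exact: unit_law_integrable.
- by apply/Lfun1_integrable; exact: unit_law_integrable.
- by apply/Lfun1_integrable; exact: unit_law_integrable.
rewrite [X in ('E_G[X])%E](_ : _ = (fun x : R => x ^+ 2))//.
by rewrite !unit_law_expectation//= -mean_unit_law.
Qed.

End unit_law.

(** * The joint law of finitely many verdicts as moments of the latent law *)

Section gate_model.
Context {R : realType} (M : gateModel R).
Local Notation P := (prob M).
(** An event of probability one on which the Bernoulli masses are nonnegative. It is the set [B] at
    which [verdict_iid] is applied. *)
Let D : set (Defs.space M) := alpha M @^-1` `[0, 1].

Lemma latent_law01 : latent_law M `[0, 1]%classic = 1%E.
Proof. exact: alpha_supp. Qed.

Let mD : measurable D.
Proof. by rewrite -[D]setTI; exact: measurable_funPT. Qed.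

Lemma measurable_verdict (S : set nat) (v : nat -> bool) :
  measurable [set t | forall i, S i -> verdict M i t = v i].
Proof.
rewrite (_ : mkset _ = \bigcap_(i in S) (verdict M i @^-1` [set v i])).
  apply: bigcap_measurableType => i _.
  by rewrite -[_ @^-1` _]setTI; exact: measurable_funPT.
by apply/seteqP; split.
Qed.

Let bernoulli_prod_ge0 t k (c v : nat -> bool) : D t ->
  0 <= \prod_(i < k | c i) bernoulli_pmf (alpha M t) (v i).
Proof.
rewrite /D/= in_itv/= => a01.
by apply: prodr_ge0 => i _; exact: bernoulli_pmf_ge0.
Qed.

Let measurable_bernoulli_prod k (c v : nat -> bool) : measurable_fun D
  (fun t => (\prod_(i < k | c i) bernoulli_pmf (alpha M t) (v i))%:E).
Proof.
apply/measurable_EFinP/measurable_funTS.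
rewrite (_ : (fun t => _) = fun t => \prod_(i < k)
    (if c i then bernoulli_pmf (alpha M t) (v i) else 1)); last first.
  by apply/funext => t; rewrite big_mkcond.
apply: measurable_prod => i _; case: (c i) => //.
rewrite /bernoulli_pmf; case: (v i) => //.
exact: measurable_funB.
Qed.

Let event (S : nat -> bool) (v : nat -> bool) : set (Defs.space M) :=
  [set t | forall i, S i -> verdict M i t = v i].

(* The factors of the indices below [l] outside [c] are summed out one by one,
   using alpha + (1 - alpha) = 1. *)
Let verdict_marginal_rec k (c v : nat -> bool) l :
  P (D `&` event (fun i => (i < k)%N && ((i < l)%N ==> c i)) v)
  = (\int[P]_(t in D)
      (\prod_(i < k | (i < l)%N ==> c i) bernoulli_pmf (alpha M t) (v i))%:E)%E.
Proof.
elim: l v => [|l IH] v.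
  rewrite -verdict_iid//; congr (P (_ `&` _)).
  apply/seteqP; split => t /= h i; [move=> ik|rewrite andbT]; apply: h.
  by rewrite ik.
(* If [k <= l] or [c l], passing from [l] to [l.+1] changes neither the event nor the product.
   Otherwise the constraint on gate [l] disappears, and the event splits according to the verdict
   [b] of gate [l], recorded by [w b]. *)
have [[kl|cl]|/not_orP[/negP lk /negP cl]] :=
    pselect ((k <= l)%N \/ c l).
- rewrite (_ : event _ _ =
    event (fun i => (i < k)%N && ((i < l)%N ==> c i)) v); last first.
    apply/seteqP; split => t /= h i /andP[ik ci]; apply: h; move: ci;
      by rewrite ik (leq_trans ik kl) (leq_trans ik (leqW kl)).
  rewrite IH; apply: eq_integral => t _; congr EFin; apply: eq_bigl => i.
  by rewrite (leq_trans (ltn_ord i) kl) (leq_trans (ltn_ord i) (leqW kl)).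
- have E i : ((i < l.+1)%N ==> c i) = ((i < l)%N ==> c i).
    by rewrite ltnS leq_eqVlt; case: eqVneq => [->|//]; rewrite ltnn cl.
  under eq_integral do under eq_bigl do rewrite E.
  rewrite -IH; congr (P (_ `&` _)).
  by apply/seteqP; split => t /= h i; [rewrite -E|rewrite E]; apply: h.
rewrite -ltnNge in lk.
pose cl' i := (i < l)%N ==> c i.
pose w b := fun i : nat => if i == l then b else v i.
have E i : ((i < l.+1)%N ==> c i) = ((i < l)%N ==> c i) && (i != l).
  rewrite ltnS leq_eqVlt; case: eqVneq => [->|//]; last by rewrite andbT.
  by rewrite (negbTE cl) andbF.
rewrite (_ : D `&` _ =
    (D `&` event (fun i => (i < k)%N && ((i < l)%N ==> c i)) (w true)) `|`
    (D `&` event (fun i => (i < k)%N && ((i < l)%N ==> c i)) (w false)));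
    last first.
  rewrite -setIUr; congr (_ `&` _); apply/seteqP; split => t /=.
    move=> h; case vl : (verdict M l t); [left|right] => i /andP[ik ci];
      rewrite /w; case: eqVneq => [->//|il]; apply: h; by rewrite E ik ci.
  by move=> [] h i; rewrite E andbA => /andP[/h]; rewrite /w => + /negbTE il;
    rewrite il.
rewrite measureU; last 3 first.
- by apply: measurableI => //; exact: measurable_verdict.
- by apply: measurableI => //; exact: measurable_verdict.
- apply/seteqP; split => // t /= [[_ /(_ l)] + [_ /(_ l)]].
  by rewrite lk ltnn/= /w eqxx => -> // /(_ isT).
rewrite [X in (X + _)%E](IH (w true)) [X in (_ + X)%E](IH (w false)).
rewrite -ge0_integralD//; last 4 first.
- by move=> t Dt; rewrite lee_fin (bernoulli_prod_ge0 t k cl' (w true)).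
- exact: (measurable_bernoulli_prod k cl' (w true)).
- by move=> t Dt; rewrite lee_fin (bernoulli_prod_ge0 t k cl' (w false)).
- exact: (measurable_bernoulli_prod k cl' (w false)).
apply: eq_integral => t _; rewrite -EFinD; congr EFin.
have F b : \prod_(i < k | (i < l)%N ==> c i) bernoulli_pmf (alpha M t) (w b i)
    = bernoulli_pmf (alpha M t) b *
      \prod_(i < k | (i < l.+1)%N ==> c i) bernoulli_pmf (alpha M t) (v i).
  rewrite (bigD1 (Ordinal lk))/= ?ltnn// {1}/w eqxx; congr (_ * _).
  apply: eq_big => [i|i /andP[_ il]]; first by rewrite E.
  by rewrite /w -[_ == l]/(i == Ordinal lk) (negbTE il).
by rewrite !F -mulrDl /bernoulli_pmf addrC subrK mul1r.
Qed.

Let setD_prob (A : set (Defs.space M)) : measurable A -> P A = P (D `&` A).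
Proof.
move=> mA; rewrite -[in LHS](setIT A) -(setUCr D) setIUr measureU; last 3 first.
- exact: measurableI.
- by apply: measurableI => //; exact: measurableC.
- by rewrite setIACA setICr setI0.
rewrite [X in (_ + X)%E](_ : _ = 0%E) ?adde0 1?setIC//.
apply: (@subset_measure0 _ _ _ P _ (~` D)).
- by apply: measurableI => //; exact: measurableC.
- exact: measurableC.
- exact: subIsetl.
- by rewrite [LHS](probability_setC P mD) [X in (1 - X)%E]alpha_supp subee.
Qed.

(** Change of variables along [alpha]. The pushforward formula is used for nonnegative integrands,
    hence the sign condition on [[0, 1]]. *)
Let integral_latent (f : R -> R) : continuous f ->
  (forall x, 0 <= x <= 1 -> 0 <= f x) ->
  (\int[P]_(t in D) (f (alpha M t))%:E)%E = (\int[latent_law M]_x f x)%:E.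
Proof.
move=> cf f0; have intf := unit_law_integrable _ latent_law01 f cf.
rewrite /Rintegral fineK; last exact: integrable_fin_num.
rewrite (negligible_integral (measurableC (measurable_itv `[0, 1])))//;
  last exact: unit_law_outside latent_law01.
rewrite setDE setTI setCK ge0_integral_pushforward//.
- apply/measurable_EFinP/measurable_funTS.
  exact: continuous_measurable_fun.
- by move=> x; rewrite inE/= in_itv/= => x01; rewrite lee_fin f0.
Qed.

Let continuous_bernoulli_prod (s : seq nat) (v : nat -> bool) :
  continuous (fun x : R => \prod_(i <- s) bernoulli_pmf x (v i)).
Proof.
move=> x; elim: s => [|i s IH].
  by under eq_fun do rewrite big_nil; exact: cvg_cst.
rewrite (_ : (fun y => _) = (fun y : R => bernoulli_pmf y (v i) *
    \prod_(j <- s) bernoulli_pmf y (v j))); last first.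
  by apply/funext => y; rewrite big_cons.
apply: (@cvgM R R (nbhs x) _ (fun y : R => bernoulli_pmf y (v i))
  (fun y : R => \prod_(j <- s) bernoulli_pmf y (v j))) => //.
rewrite /bernoulli_pmf; case: (v i); first exact: cvg_id.
by apply: cvgB; [exact: cvg_cst|exact: cvg_id].
Qed.

(** The model only prescribes initial segments of verdicts. So [k] is taken beyond every index of
    [s], and [verdict_marginal_rec] at [l = k] sums out all indices outside [s]. A repeated index
    would count its factor twice, whence [uniq s]. *)
Lemma prob_verdicts (s : seq nat) (v : nat -> bool) : uniq s ->
  P [set t | forall i, i \in s -> verdict M i t = v i]
  = (\int[latent_law M]_x \prod_(i <- s) bernoulli_pmf x (v i))%:E.
Proof.
move=> us; rewrite -integral_latent//; last first.
  by move=> x x01; apply: prodr_ge0 => i _; exact: bernoulli_pmf_ge0.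
pose k := (\max_(i <- s) i).+1.
have sk i : i \in s -> (i < k)%N by rewrite ltnS => si; exact: leq_bigmax_seq.
rewrite setD_prob; last exact: (measurable_verdict [set i | i \in s]).
have := verdict_marginal_rec k (mem s) v k.
rewrite (_ : event _ _ = event (mem s) v); last first.
  apply/seteqP; split => t /= h i.
    by move=> si; apply: h; rewrite sk//= si implybT.
  by move=> /andP[ik]; rewrite ik/=; exact: h.
move=> ->; apply: eq_integral => t _; congr EFin.
rewrite -(big_mkord (fun i => (i < k)%N ==> (i \in s))
  (fun i => bernoulli_pmf (alpha M t) (v i))).
rewrite -big_filter; apply: perm_big; apply: uniq_perm => //.
  by rewrite filter_uniq// iota_uniq.
move=> i; rewrite mem_filter mem_index_iota/=.
case si : (i \in s); first by rewrite implybT/= sk.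
by rewrite implybF; case: (i < k)%N.
Qed.

End gate_model.

(** * Covariance and correlation of two verdicts *)

Section verdict_correlation.
Context {R : realType} (M : gateModel R).
Local Notation P := (prob M).
Local Notation G := (latent_law M).

Lemma prob_verdict1 i : P [set t | verdict M i t = true] = (mean G)%:E.
Proof.
have := prob_verdicts M [:: i] (fun=> true) isT.
under [X in _ = X%:E -> _]eq_Rintegral do rewrite big_seq1.
rewrite mean_unit_law => <-; congr (P _).
apply/seteqP; split => t /=; first by move=> h k; rewrite inE => /eqP ->.
by move=> h; apply: h; rewrite inE.
Qed.

Lemma prob_verdict2 i j b c : i != j ->
  P [set t | verdict M i t = b /\ verdict M j t = c]
  = (\int[G]_x (bernoulli_pmf x b * bernoulli_pmf x c))%:E.
Proof.
move=> ij.
have := prob_verdicts M [:: i; j] (fun n => if n == i then b else c).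
rewrite /= inE ij => /(_ isT); rewrite (@eq_Rintegral _ _ _ G _
    (fun x => bernoulli_pmf x b * bernoulli_pmf x c)); last first.
  by move=> x _; rewrite big_cons big_seq1 eqxx eq_sym (negbTE ij).
move=> <-; congr (P _).
apply/seteqP; split => t /=.
  by move=> [hi hj] k; rewrite !inE; case: eqVneq => [->//|_ /eqP ->].
move=> h; split; first by rewrite h ?eqxx// inE eqxx.
by rewrite h ?inE ?eqxx ?orbT// eq_sym (negbTE ij).
Qed.

Lemma prob_verdict2_mixed i j : i != j ->
  P [set t | verdict M i t = true /\ verdict M j t = false]
  = (\int[G]_x (x * (1 - x)))%:E.
Proof. exact: prob_verdict2. Qed.

Let measurable_verdict1 i b : measurable [set t | verdict M i t = b].
Proof.
rewrite (_ : mkset _ = verdict M i @^-1` [set b])// -[_ @^-1` _]setTI.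
exact: measurable_funPT.
Qed.

(** The indices may coincide: [i = j] yields the variance of one verdict, [i != j] the covariance of
    two. *)
Let covariance_verdict i j : fine (covariance P (@bit R \o verdict M i)
    (@bit R \o verdict M j))
  = fine (P [set t | verdict M i t = true /\ verdict M j t = true])
    - mean G ^+ 2.
Proof.
have bitE k : @bit R \o verdict M k = \1_[set t | verdict M k t = true].
  apply/funext => t; rewrite /bit/= indicE; congr (_%:R : R).
  by congr nat_of_bool; apply/idP/idP; rewrite inE.
have bit2E : (@bit R \o verdict M i) * (@bit R \o verdict M j) =
    \1_[set t | verdict M i t = true /\ verdict M j t = true].
  by rewrite !bitE -[LHS]indicI.
have m2 : measurable [set t | verdict M i t = true /\ verdict M j t = true].
  exact: (measurableI _ _ (measurable_verdict1 i true)
                          (measurable_verdict1 j true)).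
have L1 A : measurable A -> (\1_A : _ -> R) \in Lfun P 1.
  by move=> mA; apply/Lfun1_integrable; exact: integrable_indic.
rewrite covarianceE ?bit2E; last 3 first.
- by rewrite bitE L1.
- by rewrite bitE L1.
- by rewrite L1.
rewrite !bitE !expectation_indic// ![P [set t | _ = true]]prob_verdict1.
by rewrite fineB ?fin_num_measure.
Qed.

Lemma rho_v_var i j : i != j -> 0 < mean G < 1 ->
  rho_v M i j = var G / (mean G * (1 - mean G)).
Proof.
move=> ij /andP[m0 m1]; rewrite /rho_v /correlation.
have varE k : fine ('V_P[@bit R \o verdict M k])%E = mean G * (1 - mean G).
  rewrite /variance covariance_verdict.
  rewrite (_ : [set t | _] = [set t | verdict M k t = true]); last first.
    by apply/seteqP; split => t /=; [case|].
  by rewrite prob_verdict1/= mulrBr mulr1 expr2.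
(* Both standard deviations are equal, so their product is the common variance. *)
rewrite !varE -expr2 sqr_sqrtr; last by rewrite mulr_ge0 ?subr_ge0 ?ltW.
rewrite covariance_verdict prob_verdict2//= var_unit_law//.
exact: latent_law01.
Qed.

(** Links the probability of two opposite verdicts to the correlation: by [rho_v_var], for a mean
    strictly between 0 and 1, the right side is [mean G * (1 - mean G)] times one minus the
    correlation. *)
Lemma integral_latent_mixed : \int[G]_x (x * (1 - x)) =
  mean G * (1 - mean G) - var G.
Proof.
rewrite var_unit_law; last exact: latent_law01.
have c1 : continuous (fun x : R => x) by move=> x; exact: cvg_id.
have c2 : continuous (fun x : R => x ^+ 2) by exact: exprn_continuous.
under eq_Rintegral do rewrite mulrBr mulr1 -expr2.
rewrite unit_lawB//; last exact: latent_law01.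
by rewrite -mean_unit_law; ring.
Qed.

End verdict_correlation.

(** * The concentration argument on [[0, 1]] *)

Section concentration.
Context {R : realType}.
Implicit Types g q : R -> R.

(** Where [|g| < e] the bound is immediate. The rest of [[0, 1]] is a compact set [A] avoiding the
    zeros of [q], so [q] has a positive minimum on it. *)
Lemma norm_le_eps_add g q (e : R) : continuous g -> continuous q ->
  (forall x, 0 <= x <= 1 -> 0 <= q x) ->
  (forall x, 0 <= x <= 1 -> q x = 0 -> g x = 0) -> 0 < e ->
  exists K, forall x, 0 <= x <= 1 -> `|g x| <= e + K * q x.
Proof.
move=> cg cq q0 qg e0.
have cng : continuous (fun x => `|g x|).
  by move=> x; apply: cvg_norm; exact: cg.
pose A := `[0, 1]%classic `&` (fun x => `|g x|) @^-1` [set y | e <= y].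
have clA : closed A.
  apply: closedI; first exact: itv_closed.
  by apply: closed_comp; [move=> x _; exact: cng|exact: closed_ge].
have cA : compact A.
  by apply: (subclosed_compact clA (@segment_compact R 0 1)) => x [].
have [A0|/set0P A0] := eqVneq A set0.
  exists 0 => x x01; rewrite mul0r addr0 leNgt; apply/negP => gx.
  suff : A x by rewrite A0.
  by split => /=; [rewrite in_itv|rewrite ltW].
have [c /set_mem[c01 cc] minq] :=
  compact_EVT_min A0 cA (continuous_subspaceT cq).
have [d _ maxg] := EVT_max ler01 (continuous_subspaceT cng).
have c01' : 0 <= c <= 1 by move: c01; rewrite /= in_itv.
have qc : 0 < q c.
  rewrite lt_neqAle q0// andbT; apply/eqP => /esym/(qg _ c01') gc.
  by move: cc; rewrite /= gc normr0 leNgt e0.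
(* The maximum of [|g|] on [[0, 1]] over the minimum of [q] on [A]. *)
exists (`|g d| / q c) => x x01.
have qx := q0 _ x01.
have [gx|gx] := ltP `|g x| e.
  by rewrite (le_trans (ltW gx))// lerDl mulr_ge0// divr_ge0// ltW.
have xA : x \in A by rewrite inE; split => //=; rewrite in_itv.
have K0 : 0 <= `|g d| / q c by rewrite divr_ge0// ltW.
have := ler_wpM2l K0 (minq _ xA).
rewrite -mulrA mulVf ?gt_eqF// mulr1 => h.
by rewrite (le_trans (maxg x _)) ?in_itv// (le_trans h)// lerDr ltW.
Qed.

(** The constant [K] of [norm_le_eps_add] depends on [e / 2] but not on [n]. Integrating the bound
    leaves [e / 2] plus [K] times the integral of [q], and the latter product is eventually at most
    [e / 2]. *)
Lemma unit_law_cvg0 (G : nat -> probability R R) g q :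
  (forall n, G n `[0, 1]%classic = 1%E) -> continuous g -> continuous q ->
  (forall x, 0 <= x <= 1 -> 0 <= q x) ->
  (forall x, 0 <= x <= 1 -> q x = 0 -> g x = 0) ->
  \int[G n]_x q x @[n --> \oo] --> (0 : R) ->
  \int[G n]_x g x @[n --> \oo] --> (0 : R).
Proof.
move=> G01 cg cq q0 qg Gq; apply/cvgr0Pnorm_le => e e0.
have e20 : 0 < e / 2 by rewrite divr_gt0.
have [K HK] := norm_le_eps_add _ _ _ cg cq q0 qg e20.
have : K * \int[G n]_x q x @[n --> \oo] --> (0 : R).
  by rewrite -(mulr0 K); apply: cvgM => //; exact: cvg_cst.
move=> /cvgr0Pnorm_le/(_ _ e20); apply: filterS => n Hn.
have cKq : continuous (fun x => K * q x).
  by move=> x; apply: cvgM; [exact: cvg_cst|exact: cq].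
have ce : continuous (fun x : R => e / 2) by move=> x; exact: cvg_cst.
have ceKq : continuous (fun x : R => e / 2 + K * q x).
  by move=> x; apply: cvgD; [exact: ce|exact: cKq].
have intE : \int[G n]_x (e / 2 + K * q x) = e / 2 + K * \int[G n]_x q x.
  by rewrite (unit_lawD _ (G01 n))// unit_law_cst unit_lawZ.
have intNE : \int[G n]_x (0 - (e / 2 + K * q x)) =
    - (e / 2 + K * \int[G n]_x q x).
  rewrite (unit_lawB _ (G01 n))// ?intE ?unit_law_cst ?sub0r//.
  by move=> x; exact: cvg_cst.
have up : \int[G n]_x g x <= e / 2 + K * \int[G n]_x q x.
  rewrite -intE; apply: (unit_law_le _ (G01 n)) => // x /HK.
  by rewrite ler_norml => /andP[].
have lo : - (e / 2 + K * \int[G n]_x q x) <= \int[G n]_x g x.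
  rewrite -intNE; apply: (unit_law_le _ (G01 n)) => //.
    by move=> x; apply: cvgB; [exact: cvg_cst|exact: ceKq].
  by move=> x /HK; rewrite ler_norml sub0r => /andP[].
move: Hn; rewrite !ler_norml => /andP[h1 h2]; apply/andP; split; lra.
Qed.

End concentration.

(** * Limits of integrals for sequences of latent laws *)

Section limit_laws.
Context {R : realType}.

Lemma expectation_point_mass (p : R) (f : R -> R) : continuous f ->
  ('E_(point_mass p)[f])%E = (f p)%:E.
Proof.
move=> /continuous_measurable_fun mf.
by rewrite unlock integral_dirac ?diracT ?mul1e//; exact/measurable_EFinP.
Qed.

Lemma integral_two_point (p : R) (f : R -> R) : 0 <= p <= 1 -> continuous f ->
  (\int[two_point p]_x (f x)%:E)%E = (p * f 1 + (1 - p) * f 0)%:E.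
Proof.
move=> p01 /continuous_measurable_fun/measurable_EFinP mf.
(* The transfer formula is for nonnegative integrands, so [f] is split into its positive and
   negative parts; [pos_neg] recombines them. *)
rewrite integralE !ge0_integral_distribution//; last 2 first.
- exact: measurable_funeneg.
- exact: measurable_funepos.
rewrite !integral_bernoulli_prob//= !funeposE !funenegE /bit/=.
rewrite -!EFin_max -!EFinM -!EFinD; congr EFin; rewrite /unstable.onem.
have pos_neg (a : R) : Num.max a 0 = a + Num.max (- a) 0.
  by case: (leP a 0) => a0; case: (leP (- a) 0) => Na0; lra.
by rewrite (pos_neg (f 1)) (pos_neg (f 0)); ring.
Qed.

Lemma expectation_two_point (p : R) (f : R -> R) : 0 <= p <= 1 ->
  continuous f -> ('E_(two_point p)[f])%E = (p * f 1 + (1 - p) * f 0)%:E.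
Proof. by move=> p01 cf; rewrite unlock integral_two_point. Qed.

Variable G : nat -> probability R R.
Hypothesis G01 : forall n, G n `[0, 1]%classic = 1%E.

Lemma cvg_expectation_unit_law (f : R -> R) (l : R) : continuous f ->
  \int[G n]_x f x @[n --> \oo] --> l -> ('E_(G n)[f])%E @[n --> \oo] --> l%:E.
Proof.
move=> cf fl; apply/cvg_EFin.
  by apply: nearW => n; rewrite unit_law_expectation.
rewrite (_ : fine \o _ = fun n => \int[G n]_x f x)//.
by apply/funext => n /=; rewrite unit_law_expectation.
Qed.

(** [unit_law_cvg0] for [f - f c] and [(x - c) ^+ 2]: the integral of the latter is the variance,
    and [c] is its only zero. *)
Lemma var_cvg0_integral (c : R) (f : R -> R) : (forall n, mean (G n) = c) ->
  var (G n) @[n --> \oo] --> (0 : R) -> continuous f ->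
  \int[G n]_x f x @[n --> \oo] --> f c.
Proof.
move=> Gc vG cf.
have cc (a : R) : continuous (fun _ : R => a) by move=> x; exact: cvg_cst.
have c1 : continuous (fun x : R => x) by move=> x; exact: cvg_id.
have c2 : continuous (fun x : R => x ^+ 2) by exact: exprn_continuous.
have cq : continuous (fun x : R => (x - c) ^+ 2).
  by move=> x; apply: cvgM; apply: cvgB => //; exact: cc.
have cg : continuous (fun x => f x - f c).
  by move=> x; apply: cvgB; [exact: cf|exact: cc].
have intq n : \int[G n]_x ((x - c) ^+ 2) = var (G n).
  rewrite var_unit_law// Gc.
  have -> : \int[G n]_x ((x - c) ^+ 2) =
      \int[G n]_x (x ^+ 2 + ((- (2 * c)) * x + c ^+ 2)).
    by apply: eq_Rintegral => x _; ring.
  have cZ : continuous (fun x : R => - (2 * c) * x).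
    by move=> x; apply: cvgM; [exact: cc|exact: c1].
  rewrite unit_lawD ?unit_lawD ?unit_lawZ ?unit_law_cst//; last first.
    by move=> x; apply: cvgD; [exact: cZ|exact: cc].
  by rewrite -mean_unit_law Gc; ring.
have : \int[G n]_x (f x - f c) @[n --> \oo] --> (0 : R).
  apply: (unit_law_cvg0 G _ _ G01 cg cq).
  - by move=> x _; exact: sqr_ge0.
  - by move=> x _ /eqP; rewrite sqrf_eq0 subr_eq0 => /eqP ->; rewrite subrr.
  - by under eq_fun do rewrite intq.
move=> /cvgD/(_ (cvg_cst (f c))); rewrite add0r.
apply: cvg_trans; apply: near_eq_cvg; apply: nearW => n /=.
transitivity (\int[G n]_x (f x - f c) + f c) => //.
by rewrite unit_lawB// unit_law_cst subrK.
Qed.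

(** Subtracting from [f] its chord between 0 and 1 gives a function vanishing at both zeros of
    [x * (1 - x)], while the integral of the chord depends on the mean alone. *)
Lemma mixed_cvg0_integral (p : R) (f : R -> R) :
  mean (G n) @[n --> \oo] --> p ->
  \int[G n]_x (x * (1 - x)) @[n --> \oo] --> (0 : R) -> continuous f ->
  \int[G n]_x f x @[n --> \oo] --> p * f 1 + (1 - p) * f 0.
Proof.
move=> mp qG cf.
have cc (a : R) : continuous (fun _ : R => a) by move=> x; exact: cvg_cst.
have c1 : continuous (fun x : R => x) by move=> x; exact: cvg_id.
have cq : continuous (fun x : R => x * (1 - x)).
  by move=> x; apply: cvgM => //; apply: cvgB => //; exact: cc.
have cl : continuous (fun x : R => (f 1 - f 0) * x).
  by move=> x; apply: cvgM => //; exact: cc.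
have cl' : continuous (fun x : R => (f 1 - f 0) * x + f 0).
  by move=> x; apply: cvgD; [exact: cl|exact: cc].
have cg : continuous (fun x => f x - ((f 1 - f 0) * x + f 0)).
  by move=> x; apply: cvgB; [exact: cf|exact: cl'].
have h1 : \int[G n]_x (f x - ((f 1 - f 0) * x + f 0)) @[n --> \oo] --> (0 : R).
  apply: (unit_law_cvg0 G _ _ G01 cg cq) => //.
  - by move=> x /andP[x0 x1]; rewrite mulr_ge0// subr_ge0.
  - move=> x _ /eqP; rewrite mulf_eq0 subr_eq0 => /orP[|]/eqP xE.
      by rewrite xE; ring.
    by rewrite -xE; ring.
have h2 : (f 1 - f 0) * mean (G n) + f 0 @[n --> \oo] -->
    (f 1 - f 0) * p + f 0.
  by apply: cvgD; [apply: cvgM => //; exact: cvg_cst|exact: cvg_cst].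
rewrite (_ : p * f 1 + (1 - p) * f 0 = 0 + ((f 1 - f 0) * p + f 0));
  last by ring.
apply: cvg_trans (cvgD h1 h2); apply: near_eq_cvg; apply: nearW => n /=.
transitivity (\int[G n]_x (f x - ((f 1 - f 0) * x + f 0)) +
  ((f 1 - f 0) * mean (G n) + f 0)) => //.
rewrite unit_lawB// unit_lawD// unit_lawZ// unit_law_cst -mean_unit_law.
by rewrite subrK.
Qed.

End limit_laws.

(** * The two limits of the correlation *)

Section gate_limits.
Context {R : realType}.
Variables i j : nat.
Hypothesis ij : i != j.

Lemma rho_v_cvg0 (M : nat -> gateModel R) (abar : R) : 0 < abar < 1 ->
  (forall n, mean (latent_law (M n)) = abar) ->
  rho_v (M n) i j @[n --> \oo] --> (0 : R) ->
  weak_cvg (fun n => latent_law (M n)) (point_mass abar) /\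
  (forall (l0 : R) (k : nat),
     log_odds (latent_law (M n)) l0 k @[n --> \oo]
       --> odds_law l0 (1 / abar) k).
Proof.
move=> a01 mM rho0; have /andP[a0 a1] := a01.
pose G n := latent_law (M n).
have G01 n : G n `[0, 1]%classic = 1%E by exact: latent_law01.
have vG : var (G n) @[n --> \oo] --> (0 : R).
  (* With the mean fixed, the variance is the correlation times a constant. *)
  rewrite -(mul0r (abar * (1 - abar))).
  rewrite (_ : (fun n => var (G n)) =
    (fun n => rho_v (M n) i j * (abar * (1 - abar)))).
    by apply: cvgM => //; exact: cvg_cst.
  apply/funext => n; rewrite rho_v_var// mM// divfK//.
  by rewrite mulf_neq0// ?subr_eq0 gt_eqF.
split=> [f cf _|l0 k].
  rewrite expectation_point_mass//; apply: cvg_expectation_unit_law => //.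
  exact: var_cvg0_integral.
rewrite /log_odds /odds_law.
rewrite (_ : l0 + k%:R * ln (1 / abar) = l0 - ln (abar ^+ k)); last first.
  by rewrite div1r lnV ?posrE// lnXn// mulrN mulr_natl.
apply: cvgB; first exact: cvg_cst.
(* Powers are in general unbounded on the line, so [weak_cvg] does not cover them;
   [var_cvg0_integral] asks for continuity only. The limit is positive, so [ln] is continuous
   there. *)
have h : \int[G n]_x (x ^+ k) @[n --> \oo] --> abar ^+ k.
  exact: (var_cvg0_integral _ G01 _ _ mM vG (@exprn_continuous R k)).
have lnc := continuous_ln (exprn_gt0 k a0).
have := cvg_comp _ _ h lnc.
apply: cvg_trans; apply: near_eq_cvg; apply: nearW => n /=.
by rewrite unlock.
Qed.

(** The means may oscillate or approach 0 or 1. As [m * (1 - m) <= 1], the integral is still at most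
    [|1 - rho|]. *)
Lemma rho_v_cvg1_mixed (M : nat -> gateModel R) :
  (forall n, 0 < mean (latent_law (M n)) < 1) ->
  rho_v (M n) i j @[n --> \oo] --> (1 : R) ->
  \int[latent_law (M n)]_x (x * (1 - x)) @[n --> \oo] --> (0 : R).
Proof.
move=> m01 rho1.
have h : `|1 - rho_v (M n) i j| @[n --> \oo] --> (0 : R).
  rewrite -(normr0 R) -(subrr (1 : R)); apply: cvg_norm.
  by apply: cvgB => //; exact: cvg_cst.
apply/norm_cvg0P.
apply: (squeeze_cvgr _ (cvg_cst 0) h); apply: nearW => n.
rewrite normr_ge0/= integral_latent_mixed.
have /andP[m0 m1] := m01 n; rewrite rho_v_var//.
set m := mean _ in m0 m1 *; set v := var _.
have mm0 : 0 < m * (1 - m) by rewrite mulr_gt0// subr_gt0.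
have -> : m * (1 - m) - v = (m * (1 - m)) * (1 - v / (m * (1 - m))).
  by rewrite [RHS]mulrBr mulr1 [_ * (v / _)]mulrC divfK ?gt_eqF.
rewrite normrM gtr0_norm// ler_piMl//; nra.
Qed.

(** A gate succeeds on an error by rejecting it. In this event gate 0 misses the error and another
    of the first [k] gates catches it, which contradicts success immediately or never. *)
Local Notation early_success M k :=
  [set t | verdict M 0 t = true /\
             exists2 m, (m < k)%N & verdict M m t = false].

Let mixed (M : gateModel R) m :=
  [set t | verdict M 0 t = true /\ verdict M m t = false].

Let measurable_mixed M m : measurable (mixed M m).
Proof.
have mV l b : measurable [set t | verdict M l t = b].
  have := measurable_verdict M [set l] (fun=> b).
  congr measurable; apply/seteqP; split => t /=; first exact.
  by move=> h l' ->.
exact: (measurableI _ _ (mV _ _) (mV _ _)).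
Qed.

Let early_successE M k : early_success M k = \big[setU/set0]_(m < k) mixed M m.
Proof.
rewrite -bigcup_mkord; apply/seteqP; split => t /=.
  by move=> [h0 [m mk hm]]; exists m.
by move=> [m /= mk [h0 hm]]; split => //; exists m.
Qed.

(** Union bound over the rejecting gate [m]. Each nonempty term pairs gate 0 with a different
    gate. *)
Lemma prob_early_success_le (M : gateModel R) k :
  (prob M (early_success M k)
   <= (k%:R * \int[latent_law M]_x (x * (1 - x)))%:E)%E.
Proof.
rewrite early_successE.
apply: (le_trans (@Boole_inequality _ _ _ (prob M) (mixed M) k
  (fun m _ => measurable_mixed M m))).
rewrite mulr_natl -[k in _ *+ k]card_ord -sumr_const.
rewrite -sumEFin; apply: lee_sum => m _.
have [m0|m0] := eqVneq (m : nat) 0%N.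
  rewrite (_ : mixed M m = set0) ?measure0; last first.
    by apply/seteqP; split => t //=; rewrite m0 => -[->].
  (* The integral is itself a probability, hence nonnegative. *)
  by rewrite -(prob_verdict2_mixed M 0 1).
by rewrite -(prob_verdict2_mixed M 0 m)// eq_sym.
Qed.

Lemma rho_v_cvg1 (M : nat -> gateModel R) :
  (forall n, 0 < mean (latent_law (M n)) < 1) ->
  rho_v (M n) i j @[n --> \oo] --> (1 : R) ->
  (forall p : R, mean (latent_law (M n)) @[n --> \oo] --> p ->
     weak_cvg (fun n => latent_law (M n)) (two_point p)) /\
  (forall k : nat,
     prob (M n) [set t | verdict (M n) 0 t = true /\
                   exists2 m, (m < k)%N & verdict (M n) m t = false]
       @[n --> \oo] --> 0%E).
Proof.
move=> m01 rho1; have qG := rho_v_cvg1_mixed M m01 rho1.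
have G01 n : latent_law (M n) `[0, 1]%classic = 1%E by exact: latent_law01.
split=> [p mp f cf _|k].
  (* The formula for [two_point p] requires this range, which the limit inherits from the means. *)
  have p01 : 0 <= p <= 1.
    apply/andP; split.
      by apply: (cvgr_to_ge mp); apply: nearW => n; have /andP[/ltW] := m01 n.
    by apply: (cvgr_to_le mp); apply: nearW => n; have /andP[_ /ltW] := m01 n.
  rewrite expectation_two_point//.
  by apply: cvg_expectation_unit_law => //; exact: mixed_cvg0_integral.
pose I n := \int[latent_law (M n)]_x (x * (1 - x)).
have h : (k%:R * I n)%:E @[n --> \oo] --> 0%E.
  apply/cvg_EFin; first exact: nearW.
  by rewrite -(mulr0 k%:R); apply: cvgM => //; exact: cvg_cst.
apply: (squeeze_cvge _ (cvg_cst 0%E) h); apply: nearW => n.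
by rewrite measure_ge0 prob_early_success_le.
Qed.

(** [x * (1 - x)] vanishes at 0 and 1, so each [early_success M k] is null; the exceptional set lies
    in their countable union. *)
Lemma two_point_verdicts (M : gateModel R) (p : R) : 0 <= p <= 1 ->
  (forall B : set R, measurable B -> latent_law M B = two_point p B) ->
  {ae prob M, forall t, verdict M 0 t = false \/
                        forall m, verdict M m t = true}.
Proof.
move=> p01 MG.
have q0 : \int[latent_law M]_x (x * (1 - x)) = 0.
  rewrite /Rintegral (@eq_measure_integral _ _ _ _ (two_point p)); last first.
    by move=> B mB _; exact: MG.
  rewrite integral_two_point//=; first by rewrite !(mul0r,mulr0,subrr,addr0).
  move=> x; apply: cvgM; first exact: cvg_id.
  by apply: cvgB; [exact: cvg_cst|exact: cvg_id].
suff : (prob M).-negligible (\bigcup_k early_success M k).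
  apply: negligibleS => t /= /not_orP[/eqP h0 /existsNP[m /eqP hm]].
  exists m.+1 => //; split; first by move: h0; case: (verdict M 0 t).
  by exists m => //; move: hm; case: (verdict M m t).
apply: negligible_bigcup => k.
exists (early_success M k); split => //.
  by rewrite early_successE; apply: bigsetU_measurable => m _.
apply/eqP; rewrite eq_le measure_ge0 andbT.
by rewrite (le_trans (prob_early_success_le M k))// q0 mulr0.
Qed.

End gate_limits.

(** * Integration by parts for the Beta kernel *)

Section beta_kernel.
Context {R : realType}.
Local Notation mu := (@lebesgue_measure R).

(** Unshifted exponents make this family stable under differentiation; [beta_kernel a b] is
    [F (a - 1) (b - 1)]. *)
Let F (a b x : R) := x `^ a * (1 - x) `^ b.

Let is_derive_onem_powR (b x : R) : x < 1 ->
  is_derive x (1 : R) (fun x : R => (1 - x) `^ b) (- (b * (1 - x) `^ (b - 1))).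
Proof.
move=> x1; have y0 : 0 < 1 - x by rewrite subr_gt0.
have d1 : is_derive x (1 : R) (fun x : R => 1 - x) (-1).
  by apply: is_derive_eq; rewrite add0r mul1r.
have d2 := is_derive1_powR b y0.
rewrite -[X in is_derive _ _ _ X]mulrN1.
exact: (@is_derive1_comp _ (@powR R ^~ b) (fun x : R => 1 - x)).
Qed.

Let is_derive_F (a b x : R) : 0 < x < 1 -> is_derive x (1 : R) (F a b)
  (a * (x `^ (a - 1) * (1 - x) `^ b) - b * (x `^ a * (1 - x) `^ (b - 1))).
Proof.
move=> /andP[x0 x1].
have d1 := is_derive1_powR a x0; have d2 := is_derive_onem_powR b x x1.
apply: is_derive_eq (is_deriveM d1 d2) _.
by rewrite /GRing.scale/=; ring.
Qed.

Let continuous_F (a b x : R) : 0 < x < 1 -> {for x, continuous (F a b)}.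
Proof.
move=> x01; apply: differentiable_continuous; apply/derivable1_diffP.
exact: (@ex_derive _ _ _ _ _ _ _ (is_derive_F a b x x01)).
Qed.

Let within_continuous_F (a b u v : R) : 0 < u -> v < 1 ->
  {within `[u, v], continuous (F a b)}.
Proof.
move=> u0 v1; apply: derivable_within_continuous => x.
rewrite in_itv/= => /andP[ux xv].
apply: (@ex_derive _ _ _ _ _ _ _ (is_derive_F a b x _)).
by rewrite (lt_le_trans u0) ?(le_lt_trans xv).
Qed.

(** The fundamental theorem of calculus away from the possible singularities at 0 and 1. No integral
    is subtracted, so the limit can be taken before the integrals over []0, 1[] are known to be
    finite. *)
Let integral_F_segment (a b u v : R) : 0 < u -> u < v -> v < 1 ->
  (\int[mu]_(x in `[u, v]) (a * F (a - 1) b x)%:E =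
   \int[mu]_(x in `[u, v]) (b * F a (b - 1) x)%:E
     + (F a b v - F a b u)%:E)%E.
Proof.
move=> u0 uv v1.
have cM (c : R) (g : R -> R) : {within `[u, v], continuous g} ->
    {within `[u, v], continuous (fun x : R => c * g x)}.
  by move=> cg x; apply: cvgM; [exact: cvg_cst|exact: cg].
have c1 : {within `[u, v], continuous (fun x => a * F (a - 1) b x)}.
  by apply: cM; exact: within_continuous_F.
have c2 : {within `[u, v], continuous (fun x => b * F a (b - 1) x)}.
  by apply: cM; exact: within_continuous_F.
have c3 : {within `[u, v], continuous
    (fun x => a * F (a - 1) b x - b * F a (b - 1) x)}.
  by move=> x; apply: cvgB; [exact: c1|exact: c2].
have i1 := @continuous_compact_integrable R _ _ (@segment_compact R u v) c1.
have i2 := @continuous_compact_integrable R _ _ (@segment_compact R u v) c2.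
have in01 x : u <= x <= v -> 0 < x < 1.
  by move=> /andP[ux xv]; rewrite (lt_le_trans u0) ?(le_lt_trans xv).
have := @continuous_FTC2 R _ (F a b) u v uv c3.
rewrite (_ : (\int[mu]_(x in `[u, v]) _)%E =
  (\int[mu]_(x in `[u, v]) (a * F (a - 1) b x)%:E -
   \int[mu]_(x in `[u, v]) (b * F a (b - 1) x)%:E)%E); last first.
  by rewrite -integralB_EFin.
move=> H; rewrite EFinB -H.
- by rewrite addeC subeK//; exact: integrable_fin_num.
- split.
  + move=> x; rewrite in_itv/= => /andP[ux xv].
    apply: (@ex_derive _ _ _ _ _ _ _ (is_derive_F a b x _)).
    by rewrite in01// !ltW.
  + by apply: cvg_at_right_filter; apply: continuous_F; rewrite in01// lexx ltW.
  + by apply: cvg_at_left_filter; apply: continuous_F; rewrite in01// lexx ltW.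
- move=> x; rewrite in_itv/= => /andP[ux xv].
  rewrite derive1E; apply: (@derive_val _ _ _ _ _ _ _ (is_derive_F a b x _)).
  by rewrite in01// !ltW.
Qed.

Let measurable_F a b : measurable_fun setT (F a b).
Proof.
apply: measurable_funM; first exact: measurable_powR.
apply: (measurableT_comp (measurable_powR b)).
exact: measurable_funB.
Qed.

Let F_ge0 a b x : 0 <= F a b x.
Proof. by rewrite mulr_ge0// powR_ge0. Qed.

(** Starting at [1 / 3] keeps [e n] below [1 / 2], so that each [[e n, 1 - e n]] is a nondegenerate
    segment. *)
Let e n : R := n.+3%:R^-1.

Let e_gt0 n : 0 < e n. Proof. by rewrite invr_gt0. Qed.

Let e_lt n : e n < 1 - e n.
Proof.
have : e n < 2^-1 by rewrite ltf_pV2 ?posrE ?ltr_nat.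
lra.
Qed.

Let e_cvg : e n @[n --> \oo] --> (0 : R).
Proof.
have := @cvg_harmonic R; rewrite -(cvg_shiftn 2).
apply: cvg_trans; apply: near_eq_cvg; apply: nearW => n.
by rewrite /= /harmonic addn2.
Qed.

Let powR_e_cvg (c : R) : 0 < c -> (e n) `^ c @[n --> \oo] --> (0 : R).
Proof. by move=> c0; move/cvg_at_rightP : (powR_cvg0 c0); apply. Qed.

Let powR_le1 (x c : R) : 0 <= x <= 1 -> 0 < c -> x `^ c <= 1.
Proof.
move=> /andP[x0 x1] c0; rewrite -[leRHS](congr1 (@^~ c) (powR1 R)).
by apply: ge0_ler_powR => //; rewrite ?nnegrE// ltW.
Qed.

(** At each endpoint one factor is at most 1 and the other is a positive power of [e n]. *)
Let F_boundary_cvg (a b : R) : 0 < a -> 0 < b ->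
  (F a b (1 - e n) - F a b (e n))%:E @[n --> \oo] --> 0%E.
Proof.
move=> a0 b0; apply/cvg_EFin; first exact: nearW.
rewrite -(subrr (0 : R)); apply: cvgB.
- apply: (squeeze_cvgr _ (cvg_cst 0) (powR_e_cvg b b0)); apply: nearW => n.
  rewrite F_ge0/= /F opprB addrCA subrr addr0 ler_piMl ?powR_ge0// powR_le1//.
  by have := e_gt0 n; have := e_lt n; lra.
- apply: (squeeze_cvgr _ (cvg_cst 0) (powR_e_cvg a a0)); apply: nearW => n.
  rewrite F_ge0/= /F ler_piMr ?powR_ge0// powR_le1//.
  by have := e_gt0 n; have := e_lt n; lra.
Qed.

Let bigcup_e : \bigcup_n `[e n, 1 - e n]%classic = `]0, 1[%classic.
Proof.
apply/seteqP; split => x /=.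
  move=> [n _] /=; rewrite !in_itv/= => /andP[ex xe].
  by have := e_gt0 n; lra.
rewrite in_itv/= => /andP[x0 x1].
have m0 : 0 < Num.min x (1 - x) by rewrite lt_min x0 subr_gt0.
have [n _ Hn] := cvgr0_norm_le _ e_cvg _ m0.
exists n => //=; have := Hn n (leqnn n); rewrite in_itv/= gtr0_norm// le_min.
lra.
Qed.

Let nondecreasing_e : nondecreasing_seq (fun n => `[e n, 1 - e n]%classic).
Proof.
move=> m n mn; rewrite subsetEset => x /=; rewrite !in_itv/=.
have : e n <= e m by rewrite lef_pV2 ?posrE// ler_nat.
lra.
Qed.

Lemma measurable_beta_kernel (a b : R) : measurable_fun setT (beta_kernel a b).
Proof. exact: measurable_F. Qed.

Lemma beta_kernel_ge0 (a b x : R) : 0 <= beta_kernel a b x.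
Proof. exact: F_ge0. Qed.

(* Integrates the derivative of [x^a (1 - x)^b], which vanishes at 0 and 1. *)
Lemma integral_beta_kernel_swap (a b : R) : 0 < a -> 0 < b ->
  (\int[mu]_(x in `]0%R, 1%R[) (a * beta_kernel a (b + 1) x)%:E =
   \int[mu]_(x in `]0%R, 1%R[) (b * beta_kernel (a + 1) b x)%:E)%E.
Proof.
move=> a0 b0; rewrite /beta_kernel !addrK.
(* Monotone convergence along the segments exhausting []0, 1[], valid even for an infinite limit. *)
have cvgF (c c' d : R) : 0 < c ->
    (\int[mu]_(x in `[e n, (1 - e n)%R]) (c * F c' d x)%:E)%E @[n --> \oo] -->
    (\int[mu]_(x in `]0%R, 1%R[) (c * F c' d x)%:E)%E.
  move=> c0; rewrite -bigcup_e; apply: ge0_nondecreasing_set_cvg_integral => //.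
  - move=> n; apply/measurable_EFinP/measurable_funTS.
    by apply: measurable_funM; [exact: measurable_cst|exact: measurable_F].
  - by move=> n x _; rewrite lee_fin mulr_ge0// ltW.
have h1 := cvgF a (a - 1) b a0.
have h2 := cvgF b a (b - 1) b0.
have h3 := F_boundary_cvg a b a0 b0.
have h0 : (0%E : \bar R) \is a fin_num by [].
have := cvgeD (fin_num_adde_defl _ h0) h2 h3; rewrite adde0 => h4.
suff h5 : (\int[mu]_(x in `[e n, (1 - e n)%R]) (a * F (a - 1) b x)%:E)%E
    @[n --> \oo] --> (\int[mu]_(x in `]0%R, 1%R[) (b * F a (b - 1) x)%:E)%E.
  exact: cvg_unique h1 h5.
under eq_fun => n do rewrite integral_F_segment ?gtrBl//.
exact: h4.
Qed.

End beta_kernel.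

(** * Integration against a law with a density *)

Section density.
Context {R : realType}.
Local Notation mu := (@lebesgue_measure R).

(** [g] and the Radon-Nikodym derivative of [G] have the same integral over every measurable set, so
    they agree almost everywhere. *)
Let integral_density_lebesgue (G : probability (measurableTypeR R) R)
    (g f : measurableTypeR R -> R) :
  measurable_fun setT g ->
  (forall A : set (measurableTypeR R), measurable A ->
    G A = (\int[mu]_(x in A) (g x)%:E)%E) ->
  G.-integrable setT (EFin \o f) ->
  (\int[G]_x (f x)%:E = \int[mu]_x (f x * g x)%:E)%E.
Proof.
move=> mg Gg intf.
have dom : G `<< mu.
  apply/null_content_dominatesP => A mA muA0; rewrite Gg//.
  by apply: null_set_integral => //; apply/measurable_EFinP/measurable_funTS.
rewrite -(Radon_Nikodym_change_of_variables dom)//=.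
apply: ae_eq_integral => //.
- apply: emeasurable_funM => //; first exact: measurable_int intf.
- apply/measurable_EFinP; apply: measurable_funM => //.
  by apply/measurable_EFinP; exact: measurable_int intf.
- under [X in ae_eq _ _ _ X]eq_fun do rewrite EFinM.
  apply: ae_eqe_mul2l => /=.
  rewrite Radon_NikodymE//=.
  case: cid => /= h [h1 h2 h3].
  apply: integral_ae_eq => //=; first exact/measurable_EFinP.
  by move=> E E01 mE; rewrite -h3//= Gg.
Qed.

(* [R] and [measurableTypeR R] have the same measurable sets but different
   displays; [G] is transported to the latter, on which [lebesgue_measure] and
   hence the Radon-Nikodym derivative live. *)
Lemma integral_density (G : probability R R) (g f : R -> R) :
  measurable_fun setT g ->
  (forall A : set R, measurable A -> G A = (\int[mu]_(x in A) (g x)%:E)%E) ->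
  measurable_fun setT f ->
  G.-integrable setT (EFin \o f) ->
  (\int[G]_x (f x)%:E = \int[mu]_x (f x * g x)%:E)%E.
Proof.
move=> mg Gg mf intf.
pose id' : R -> measurableTypeR R := idfun.
have mid : measurable_fun setT id' by move=> _ A mA; rewrite setTI.
pose X : {mfun R >-> measurableTypeR R} :=
  HB.pack id' (isMeasurableFun.Build _ _ _ _ _ mid).
rewrite -(integral_density_lebesgue (distribution G X) g f)//.
  by rewrite integral_distribution//; exact/measurable_EFinP.
apply: (@integrable_pushforward _ _ _ _ _ _ mid G) => //.
exact/measurable_EFinP.
Qed.

End density.

(** * Moments of the Beta law *)

Section beta_law.
Context {R : realType} (G : probability R R) (a b : R).
Hypothesis G01 : G `[0, 1]%classic = 1%E.
Hypotheses (a0 : 0 < a) (b0 : 0 < b) (Gab : is_beta a b G).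
Local Notation mu := (@lebesgue_measure R).
Let N := beta_norm a b.

(* If the kernel had integral 0 or +oo (which [fine] maps to 0), then [N = 0]
   and, as x / 0 = 0, the law [G] would vanish. *)
Let N_gt0 : 0 < N.
Proof.
rewrite lt_neqAle; apply/andP; split; last first.
  by apply/fine_ge0/integral_ge0 => x _; rewrite lee_fin beta_kernel_ge0.
apply/eqP => N0; have := Gab setT measurableT; rewrite probability_setT -/N.
under eq_integral do rewrite -N0 invr0 mulr0.
by rewrite integral0 => /eqP; rewrite onee_eq0.
Qed.

(** [k] is a globally nonnegative form of [f] times the kernel, so the factor [N^-1] can be pulled
    out without an integrability proof for [k]. *)
Let integral_beta_law (f k : R -> R) : continuous f ->
  measurable_fun setT k -> (forall x, 0 <= k x) ->
  (forall x, 0 < x < 1 -> f x * beta_kernel a b x = k x) ->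
  (\int[G]_x (f x)%:E = \int[mu]_(x in `]0%R, 1%R[) (k x)%:E * (N^-1)%:E)%E.
Proof.
move=> cf mk k0 fk.
(* The density, extended by 0 to the whole line as [integral_density] expects. *)
pose g := (fun x => beta_kernel a b x / N) \_ `]0, 1[.
rewrite (integral_density G g f).
- rewrite -ge0_integralZr//; last 3 first.
  + exact/measurable_EFinP/measurable_funTS.
  + by move=> x _; rewrite lee_fin.
  + by rewrite lee_fin invr_ge0 ltW.
  rewrite [RHS]integral_mkcond; apply: eq_integral => x _.
  rewrite /g !patchE; case: ifPn => x01; last by rewrite mulr0.
  rewrite -EFinM mulrA fk//.
  by move: x01; rewrite inE/= in_itv.
- apply/(measurable_restrictT _ _).1 => //.
  apply: measurable_funTS; apply: measurable_funM => //.
  exact: measurable_beta_kernel.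
- move=> A mA; rewrite Gab// integral_mkcondr; apply: eq_integral => x _.
  by rewrite /g !patchE; case: ifPn.
- exact: continuous_measurable_fun.
- exact: unit_law_integrable.
Qed.

Let powR_mul (x c : R) : 0 < x -> x * x `^ (c - 1) = x `^ c.
Proof.
move=> x0; rewrite -[X in X * _]powRr1 ?ltW// -powRD.
  by rewrite addrC subrK.
by rewrite (gt_eqF x0) implybT.
Qed.

Let kernel_succl (c d x : R) : 0 < x < 1 ->
  x * beta_kernel c d x = beta_kernel (c + 1) d x.
Proof.
by move=> /andP[x0 x1]; rewrite /beta_kernel mulrA powR_mul// addrK.
Qed.

Let kernel_succr (c d x : R) : 0 < x < 1 ->
  (1 - x) * beta_kernel c d x = beta_kernel c (d + 1) x.
Proof.
move=> /andP[x0 x1]; rewrite /beta_kernel mulrCA powR_mul ?subr_gt0//.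
by rewrite addrK.
Qed.

Let cc (c : R) : continuous (fun _ : R => c).
Proof. by move=> x; exact: cvg_cst. Qed.

Let c1 : continuous (fun x : R => x).
Proof. by move=> x; exact: cvg_id. Qed.

Let c1m : continuous (fun x : R => 1 - x).
Proof. by move=> x; apply: cvgB; [exact: cc|exact: c1]. Qed.

Let c2 : continuous (fun x : R => x ^+ 2).
Proof. exact: exprn_continuous. Qed.

Let mk (c d e : R) : measurable_fun setT (fun x : R => c * beta_kernel d e x).
Proof.
apply: measurable_funM; first exact: measurable_cst.
exact: measurable_beta_kernel.
Qed.

Let k_ge0 (c d e : R) : 0 < c -> forall x, 0 <= c * beta_kernel d e x.
Proof. by move=> c0 x; rewrite mulr_ge0 ?beta_kernel_ge0// ltW. Qed.

(** Turns [integral_beta_kernel_swap] at parameters [c] and [b] into an identity between moments: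
    [c = a] serves the mean, [c = a + 1] the second moment. *)
Let swap_eq (f g : R -> R) (c : R) : 0 < c -> continuous f -> continuous g ->
  (forall x, 0 < x < 1 ->
     f x * beta_kernel a b x = c * beta_kernel c (b + 1) x) ->
  (forall x, 0 < x < 1 ->
     g x * beta_kernel a b x = b * beta_kernel (c + 1) b x) ->
  \int[G]_x f x = \int[G]_x g x.
Proof.
move=> c0 cf cg fE gE; rewrite /Rintegral; congr fine.
rewrite (integral_beta_law _ _ cf (mk _ _ _) (k_ge0 _ _ _ c0) fE).
rewrite (integral_beta_law _ _ cg (mk _ _ _) (k_ge0 _ _ _ b0) gE).
by rewrite integral_beta_kernel_swap.
Qed.

Lemma mean_beta : mean G = a / (a + b).
Proof.
have := swap_eq (fun x => a * (1 - x)) (fun x => b * x) a a0.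
rewrite !unit_lawZ// unit_lawB// unit_law_cst -mean_unit_law => H.
have {H} : a * (1 - mean G) = b * mean G.
  apply: H.
  - by move=> x; apply: cvgM; [exact: cc|exact: c1m].
  - by move=> x; apply: cvgM; [exact: cc|exact: c1].
  - by move=> x x01; rewrite -mulrA kernel_succr.
  - by move=> x x01; rewrite -mulrA kernel_succl.
move=> H; apply: (canRL (mulfK _)); first by rewrite gt_eqF// addr_gt0.
by move: H; lra.
Qed.

Lemma second_moment_beta :
  \int[G]_x (x ^+ 2) = a * (a + 1) / ((a + b) * (a + b + 1)).
Proof.
have a10 : 0 < a + 1 by rewrite addr_gt0.
have ab0 : 0 < a + b by rewrite addr_gt0.
have ab10 : 0 < a + b + 1 by rewrite addr_gt0.
(* [x - x ^+ 2] raises both kernel parameters by one, and [x ^+ 2] raises the first by two. *)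
have := swap_eq (fun x => (a + 1) * (x - x ^+ 2)) (fun x => b * x ^+ 2) _ a10.
have cB : continuous (fun x : R => x - x ^+ 2).
  by move=> x; apply: cvgB; [exact: c1|exact: c2].
rewrite !unit_lawZ// unit_lawB// -mean_unit_law mean_beta => H.
have {H} : (a + 1) * (a / (a + b) - \int[G]_x (x ^+ 2)) =
    b * \int[G]_x (x ^+ 2).
  apply: H.
  - by move=> x; apply: cvgM; [exact: cc|exact: cB].
  - by move=> x; apply: cvgM; [exact: cc|exact: c2].
  - by move=> x x01; rewrite -mulrA -kernel_succr// -kernel_succl//; ring.
  - by move=> x x01; rewrite -mulrA -!kernel_succl//; ring.
set m := \int[G]_x _ => H.
have {}H : m * (a + b + 1) = (a + 1) * (a / (a + b)) by move: H; lra.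
apply: (mulIf (lt0r_neq0 ab10)); rewrite H; field.
by rewrite !gt_eqF.
Qed.

End beta_law.

(** * The Beta correlation and the collected statement *)

Lemma rho_v_beta {R : realType} (M : gateModel R) (i j : nat) (a b : R) :
  i != j -> 0 < a -> 0 < b -> is_beta a b (latent_law M) ->
  rho_v M i j = 1 / (a + b + 1).
Proof.
move=> ij a0 b0 Gab.
have G01 := latent_law01 M.
have mE := mean_beta _ _ _ G01 a0 b0 Gab.
have ab0 : 0 < a + b by rewrite addr_gt0.
have ab10 : 0 < a + b + 1 by rewrite addr_gt0.
rewrite rho_v_var//; last first.
  by rewrite mE divr_gt0//= ltr_pdivrMr// mul1r ltrDl.
rewrite var_unit_law// (second_moment_beta _ _ _ G01 a0 b0 Gab) mE; field.
(* The denominator [a + b - a] comes from [1 - mean], with mean [a / (a + b)]. *)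
have -> : a + b - a = b by ring.
by rewrite !gt_eqF.
Qed.

Theorem proposition3p7 (R : realType) (i j : nat) (hij : i != j) :
  [/\ forall M : gateModel R,
        let G := latent_law M in
        0 < mean G < 1 ->
        rho_v M i j = var G / (mean G * (1 - mean G)),
      forall (M : gateModel R) (a b : R), 0 < a -> 0 < b ->
        is_beta a b (latent_law M) ->
        rho_v M i j = 1 / (a + b + 1),
      forall (M : nat -> gateModel R) (abar : R), 0 < abar < 1 ->
        (forall n, mean (latent_law (M n)) = abar) ->
        rho_v (M n) i j @[n --> \oo] --> (0 : R) ->
        weak_cvg (fun n => latent_law (M n)) (point_mass abar) /\
        (forall (l0 : R) (k : nat),
           log_odds (latent_law (M n)) l0 k @[n --> \oo]
             --> odds_law l0 (1 / abar) k)
    & (forall M : nat -> gateModel R,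
         (forall n, 0 < mean (latent_law (M n)) < 1) ->
         rho_v (M n) i j @[n --> \oo] --> (1 : R) ->
         (forall p : R, mean (latent_law (M n)) @[n --> \oo] --> p ->
            weak_cvg (fun n => latent_law (M n)) (two_point p)) /\
         (forall k : nat,
            prob (M n) [set t | verdict (M n) 0 t = true /\
                          exists2 m, (m < k)%N & verdict (M n) m t = false]
              @[n --> \oo] --> 0%E)) /\
      (forall (M : gateModel R) (p : R), 0 <= p <= 1 ->
         (forall B : set R, measurable B -> latent_law M B = two_point p B) ->
         {ae prob M, forall t, verdict M 0 t = false \/
                               forall m, verdict M m t = true})].
Proof.
split.
- by move=> M G mG; exact: rho_v_var.
- by move=> M a b a0 b0 Gab; exact: rho_v_beta.
- by move=> M abar; exact: rho_v_cvg0.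
- split; first by move=> M; exact: (rho_v_cvg1 i j).
  exact: two_point_verdicts.
Qed.
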